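(* Let $H$ be a real Hilbert space, $F:H\to H$ a (nonlinear) operator, and $y,f\in H$ with $F(y)=f$. Let $R>0$ and $B(y,R):=\{u\in H:\|u-y\|\le R\}$. Assume that the Fréchet derivative $F'(u)$ exists for every $u\in B(y,R)$ and depends continuously on $u$ there, that $\|[F'(y)]^{-1}\|\le m$ for a constant $m>0$, and let $$\omega(r):=\sup_{u,v\in B(y,R),\ \|u-v\|\le r}\|F'(u)-F'(v)\|,$$ where $\omega$ is continuous on $[0,2R]$, strictly increasing, with $\omega(0)=0$. Let $q\in(0,1)$ with $m\,\omega(R)=q$, and set $\rho:=\frac{(1-q)R}{m}$. Let $h\in H$ and $u_0\in H$, put $r:=\|F(u_0)-h\|$, and suppose $\|h-f\|\le\delta$ with $\delta\ge 0$ satisfying $\delta+r\le\rho$. Then the Cauchy problem $$\dot u(t)=-[F'(u(t))]^{-1}\big(F(u(t))-h\big),\qquad u(0)=u_0,$$ has a unique solution $u(t)$ defined for all $t\ge 0$, the limit $u(\infty):=\lim_{t\to\infty}u(t)$ exists, and $F(u(\infty))=h$.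
   Context: $\|\cdot\|$ denotes the norm of $H$ and the corresponding operator norm; $\dot u=du/dt$.
   Formalization: The initial point u_0 is assumed to lie in B(y,R), since otherwise F'(u_0) need not exist or be invertible and the claim fails; solutions, and hence uniqueness, are understood as curves staying in B(y,R), where F' is given. *)

(* Defs.v *)
From HB Require Import structures.
From mathcomp Require Import all_boot all_order all_algebra.
From mathcomp Require Import all_classical all_reals all_analysis.
Set Implicit Arguments. Unset Strict Implicit. Unset Printing Implicit Defensive.
Import Order.TTheory GRing.Theory Num.Theory.
Import numFieldNormedType.Exports.
Local Open Scope classical_set_scope.
Local Open Scope ring_scope.

Definition is_inner_product (R : realType) (V : completeNormedModType R)
  (ip : V -> V -> R) : Prop :=
  [/\ forall x y, ip x y = ip y x,
      forall a x y z, ip (a *: x + y) z = a * ip x z + ip y z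
    & forall x, `|x| ^+ 2 = ip x x].

Definition cball (R : realType) (V : normedModType R) (y : V) (r : R) : set V :=
  [set u | `|u - y| <= r].

Definition opnorm (R : realType) (V : normedModType R) (L : V -> V) : \bar R :=
  ereal_sup [set (`|L x|)%:E | x in [set x : V | `|x| <= 1]].

Definition omega (R : realType) (V : normedModType R) (F : V -> V) (y : V)
  (Rad r : R) : \bar R :=
  ereal_sup [set opnorm (fun x => 'd F (uv.1 : V) x - 'd F (uv.2 : V) x) |
             uv in [set uv : V * V | [/\ cball y Rad uv.1, cball y Rad uv.2
                                     & `|uv.1 - uv.2| <= r]]].

Definition is_inverse (R : realType) (V : normedModType R) (L M : V -> V) : Prop :=
  forall x, L (M x) = x /\ M (L x) = x.

(* u : R -> V solves  u'(t) = - [F'(u(t))]^{-1} (F(u(t)) - h),  u(0) = u0,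
   on [0, +oo), as a curve in the ball B(y,Rad) where F' is given
   (right derivative at t = 0, two-sided derivative for t > 0). *)
Definition dsm_solution (R : realType) (V : normedModType R) (F : V -> V)
  (y : V) (Rad : R) (h u0 : V) (u : R -> V) : Prop :=
  u 0 = u0 /\
  forall t : R, 0 <= t ->
    cball y Rad (u t) /\ differentiable F (u t) /\
    exists Minv : V -> V,
      is_inverse ('d F (u t)) Minv /\
      let rhs := - Minv (F (u t) - h) in
      (0 < t -> is_derive t 1 u rhs) /\
      (t = 0 -> (fun s => s^-1 *: (u s - u 0)) @ 0^'+ --> rhs).

(* Main.v *)
(** Put [k = omega(R)], so [m * k = q].  On the ball, [x - F'(y)^-1 (F x)] is
    [q]-Lipschitz: its derivative is [F'(y)^-1 (F'(y) - F'(x))].  Hence [F] is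
    injective there with a Lipschitz inverse, every [g] with
    [|g - f| <= (1 - q) R / m] is attained (contraction mapping principle), and
    each [F'(x)] is invertible.  Along a solution [F(u) - h] satisfies
    [p' = - p], so the solutions are exactly the curves lifting
    [h + exp(-t) (F(u0) - h)] through [F]; this curve of values stays in the
    attained ball and tends to [h]. *)
Require Import Defs.
From HB Require Import structures.
From mathcomp Require Import all_boot all_order all_algebra.
From mathcomp Require Import all_classical all_reals all_analysis.
From mathcomp Require Import ring lra.
Set Implicit Arguments. Unset Strict Implicit. Unset Printing Implicit Defensive.
Import Order.TTheory GRing.Theory Num.Theory.
Import numFieldNormedType.Exports.
Local Open Scope classical_set_scope.
Local Open Scope ring_scope.

(** * Linear maps close to an invertible one *)

Definition pack_linear (R : realType) (V W : normedModType R) (f : V -> W)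
  (flin : linear f) : {linear V -> W} :=
  HB.pack f (GRing.isLinear.Build _ _ _ _ _ flin).

(** Serves twice: with the whole space, to invert a linear map, and with the ball, to solve
    [F u = g]. *)
Lemma closed_contraction_fixpoint (R : realType) (V : completeNormedModType R)
  (U : set V) (phi : V -> V) (c : R) :
  0 <= c < 1 -> closed U -> U !=set0 -> {homo phi : x / U x} ->
  (forall x z, U x -> U z -> `|phi x - phi z| <= c * `|x - z|) ->
  exists2 x, U x & x = phi x.
Proof.
move=> /andP[c0 c1] Ucl U0 phiU phic.
pose f : {fun U >-> U} := HB.pack phi (isFun.Build _ _ _ _ phi phiU).
apply: (@banach_fixed_point _ _ _ f) => //.
exists (NngNum c0); split => //= -[x z] /= [Ux Uz].
exact: phic.
Qed.

Lemma opnorm_le (R : realType) (V : normedModType R) (L : V -> V) (c : R) :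
  scalable L -> (opnorm L <= c%:E)%E -> forall x, `|L x| <= c * `|x|.
Proof.
move=> Lsc Lc x.
have L0 : L 0 = 0 by rewrite -(scale0r 0) Lsc !scale0r.
have [->|x0] := eqVneq x 0; first by rewrite L0 !normr0 mulr0.
have nx : 0 < `|x| by rewrite normr_gt0.
rewrite -ler_pdivrMr// -lee_fin; apply: le_trans Lc.
apply: ereal_sup_ubound; exists (`|x|^-1 *: x).
  by rewrite /= normrZ normfV normr_id mulVf// gt_eqF.
by rewrite Lsc normrZ normfV normr_id mulrC.
Qed.

Lemma inverse_linear (R : realType) (V : normedModType R)
  (L M : V -> V) : linear L -> is_inverse L M -> linear M.
Proof.
move=> Llin LM a x z; have Linj : injective L.
  by move=> u v e; rewrite -(LM u).2 e (LM v).2.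
by apply: Linj; rewrite Llin !(LM _).1.
Qed.

(** From [x = M0 (L x) - M0 (L x - L0 x)]: the last term has norm at most [m * k * |x|] and is
    absorbed on the left. *)
Lemma perturbed_inverse_bound (R : realType) (V : normedModType R)
  (L L0 : {linear V -> V}) (M0 : V -> V) (m k : R) :
  is_inverse L0 M0 -> 0 <= m -> (forall x, `|M0 x| <= m * `|x|) ->
  (forall x, `|L x - L0 x| <= k * `|x|) ->
  forall x, (1 - m * k) * `|x| <= m * `|L x|.
Proof.
move=> inv0 m0 M0m Lk x.
have Mlin := inverse_linear (@linearP _ _ _ _ L0) inv0.
pose M := pack_linear Mlin.
have e : x = M (L x) - M (L x - L0 x).
  by rewrite -linearB opprB addrC subrK [RHS](inv0 x).2.
rewrite mulrBl mul1r lerBlDr {1}e (le_trans (ler_normB _ _))//.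
rewrite lerD ?M0m// -mulrA (le_trans (M0m _))//.
by rewrite ler_wpM2l.
Qed.

(** Injectivity comes from the lower bound just proved, surjectivity from a fixed point argument in
    place of a Neumann series. *)
Lemma perturbed_inverse (R : realType) (V : completeNormedModType R)
  (L L0 : {linear V -> V}) (M0 : V -> V) (m k : R) :
  is_inverse L0 M0 -> 0 <= m -> (forall x, `|M0 x| <= m * `|x|) ->
  (forall x, `|L x - L0 x| <= k * `|x|) -> 0 <= m * k < 1 ->
  exists M, is_inverse L M.
Proof.
move=> inv0 m0 M0m Lk mk.
have Lb := perturbed_inverse_bound inv0 m0 M0m Lk.
have Mlin := inverse_linear (@linearP _ _ _ _ L0) inv0.
pose M := pack_linear Mlin.
have Linj x z : L x = L z -> x = z.
  move=> e; apply/subr0_eq/eqP; rewrite -normr_le0.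
  have := Lb (x - z); rewrite linearB e subrr normr0 mulr0.
  by rewrite pmulr_rle0// subr_gt0; case/andP: mk.
have Lsurj z : exists x, L x = z.
  (* Applying [L0] to the fixed point equation gives [L0 x = z + (L0 x - L x)], that is
     [L x = z]. *)
  have [|||x _ xE] := @closed_contraction_fixpoint R V setT
      (fun x => M0 (z + (L0 x - L x))) (m * k) mk closedT _ _ _.
  - by exists 0.
  - by [].
  - move=> x1 x2 _ _; rewrite -[M0]/(M : V -> V) -linearB.
    rewrite (le_trans (M0m _))// -mulrA ler_wpM2l// (le_trans _ (Lk _))//.
    rewrite opprD addrACA subrr add0r -[leLHS]normrN opprB opprB addrACA.
    rewrite (linearB L) (linearB L0) opprB [in leRHS]addrACA.
    by rewrite [in leRHS](addrC (L x1)).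
  - exists x; apply/eqP; rewrite -subr_eq0; apply/eqP.
    have /(congr1 L0) := xE; rewrite (inv0 _).1 addrCA -{1}[L0 x]addr0.
    by move=> /addrI/esym/eqP; rewrite subr_eq0 => /eqP ->; rewrite subrr.
have [M' M'E] := choice Lsurj.
by exists M' => z; split => //; apply: Linj; rewrite M'E.
Qed.

(** * Derivatives of curves *)

Lemma is_derive1P (R : realType) (V : normedModType R) (p : R -> V) (t : R) l :
  is_derive t 1 p l <-> h^-1 *: (p (h + t) - p t) @[h --> 0^'] --> l.
Proof.
have e : (fun h : R => h^-1 *: ((p \o shift t) (h *: 1) - p t)) =
         (fun h => h^-1 *: (p (h + t) - p t)).
  by apply/funext => h; rewrite /= [h%:A]mulr1.
split=> [[d <-]|pl]; first by rewrite -e.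
by rewrite -e in pl; split; [exact: cvgP pl|exact: cvg_lim pl].
Qed.

Lemma linear_bound_continuous (R : realType) (V W : normedModType R)
  (A : V -> W) (C : R) :
  linear A -> (forall x, `|A x| <= C * `|x|) -> continuous A.
Proof.
move=> Alin AC; pose A' := pack_linear Alin.
apply: (@bounded_linear_continuous _ _ _ A').
apply/linear_boundedP; near=> r => x.
rewrite (le_trans (AC x))// ler_wpM2r//.
Unshelve. all: by end_near. Qed.

Lemma is_derive_linear (R : realType) (V W : normedModType R) (A : V -> W)
  (p : R -> V) (t : R) l :
  linear A -> continuous A -> is_derive t 1 p l -> is_derive t 1 (A \o p) (A l).
Proof.
move=> Alin Acont /is_derive1P pl; apply/is_derive1P.
pose A' := pack_linear Alin.
have -> : (fun h => h^-1 *: ((A \o p) (h + t) - (A \o p) t)) =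
          A \o (fun h => h^-1 *: (p (h + t) - p t)).
  by apply/funext => h /=; rewrite -[A]/(A' : V -> W) linearZ_LR (linearB A').
exact: (cvg_comp _ _ pl (Acont l)).
Qed.

Lemma is_derive_chain (R : realType) (V W : normedModType R) (F : V -> W)
  (p : R -> V) (t : R) l :
  is_derive t 1 p l -> differentiable F (p t) ->
  is_derive t 1 (F \o p) ('d F (p t) l).
Proof.
move=> [dp <-] dF; have dp' := (derivable1_diffP _ _).1 dp.
have dFp : differentiable (F \o p) t by exact: differentiable_comp.
split; first exact/derivable1_diffP.
by rewrite !deriveE// diff_comp.
Qed.

(** * The mean value inequality in a Hilbert space *)

Section InnerProduct.
Context (R : realType) (V : completeNormedModType R) (ip : V -> V -> R).
Context (Hip : is_inner_product ip).

Lemma ip_linear w : linear (fun x => ip x w : R^o).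
Proof. by case: Hip => _ ip_lin _ a x z; rewrite ip_lin. Qed.

Lemma cauchy_schwarz x w : `|ip x w| <= `|x| * `|w|.
Proof.
have [ipC ipL ipn] := Hip.
have ip0 z : ip 0 z = 0 by have := ipL 1 0 0 z; rewrite scale1r addr0; lra.
have ipZ a u z : ip (a *: u) z = a * ip u z.
  by rewrite -[a *: u]addr0 ipL ip0 addr0.
have [->|w0] := eqVneq w 0; first by rewrite ipC ip0 !normr0 mulr0.
have ww : 0 < ip w w by rewrite -ipn exprn_gt0// normr_gt0.
rewrite -ler_sqr ?nnegrE ?mulr_ge0// exprMn real_normK ?num_real// !ipn.
(* [z] is [ip w w] times the component of [x] orthogonal to [w], and [|z|^2 = ip w w * (ip x x * ip
   w w - (ip x w)^2)]. *)
pose z := ip w w *: x + - ip x w *: w.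
have ipz u : ip u z = ip w w * ip x u - ip x w * ip w u.
  by rewrite ipC ipL ipZ mulNr.
have := sqr_ge0 `|z|; rewrite ipn !ipz (ipC w x) => z0.
by rewrite -(ler_pM2l ww); nra.
Qed.

Lemma ip_continuous w : continuous (fun x => ip x w : R^o).
Proof.
apply: (@linear_bound_continuous _ _ _ _ `|w|); first exact: ip_linear.
by move=> x; rewrite mulrC; exact: cauchy_schwarz.
Qed.

(** Pairing with [w = p b - p a] reduces to the scalar mean value theorem:
    [|w|^2 = ip (dp s) w * (b - a)], then Cauchy-Schwarz and division by [|w|]. Derivatives are
    asked for in the open interval only, which suits a curve starting at time 0. *)
Lemma mean_value_le (p dp : R -> V) (a b c : R) :
  a <= b -> {within `[a, b], continuous p} ->
  (forall s, s \in `]a, b[ -> is_derive s 1 p (dp s)) ->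
  (forall s, s \in `]a, b[ -> `|dp s| <= c) ->
  `|p b - p a| <= c * (b - a).
Proof.
rewrite le_eqVlt => /predU1P[<-|ab] pcont pder dpc.
  by rewrite !subrr normr0 mulr0.
set w := p b - p a.
have [s sab sE] : exists2 s, s \in `]a, b[ &
    ip (p b) w - ip (p a) w = ip (dp s) w * (b - a).
  apply: (@MVT R (fun s => ip (p s) w) (fun s => ip (dp s) w)) => //.
    by move=> x xab; apply: (is_derive_linear (ip_linear w)) => //;
      [exact: ip_continuous|exact: pder].
  move=> x; apply: (@continuous_comp (subspace `[a, b]) V R^o p (fun x => ip x w)).
    exact: pcont.
  exact: ip_continuous.
(* No sign of [c] is assumed: [0 <= c] follows since [c] bounds a norm at the point [s] just
   found. *)
have [->|w0] := eqVneq w 0.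
  rewrite normr0 mulr_ge0// ?subr_ge0 ?(ltW ab)//.
  exact: le_trans (dpc _ sab).
have nw : 0 < `|w| by rewrite normr_gt0.
have [ipC ipL ipn] := Hip.
rewrite -(ler_pM2r nw) -expr2 ipn.
have -> : ip w w = ip (p b) w - ip (p a) w.
  by have := ipL (-1) (p a) (p b) w; rewrite scaleN1r addrC -/w => ->; ring.
rewrite sE mulrAC ler_pM2r ?subr_gt0//.
rewrite (le_trans (ler_norm _))// (le_trans (cauchy_schwarz _ _))//.
by rewrite ler_pM2r// dpc.
Qed.

End InnerProduct.

(** * Difference quotients of lifted curves, and the product rule *)

Lemma differentiable_le (R : realType) (V W : normedModType R) (F : V -> W) a :
  differentiable F a -> forall e, 0 < e ->
  \forall x \near a, `|F x - F a - 'd F a (x - a)| <= e * `|x - a|.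
Proof.
move=> /diff_locally /eqaddoP dF e e0.
rewrite (near_shift 0 a) subr0.
apply: filterS (dF e e0) => x /=.
by rewrite !fctE /= addrK opprD addrA.
Qed.

(** Differentiates a lift [k] knowing only its image under [F]. The Lipschitz bound on the inverse
    makes the scaled increments of [k] bounded, so the scaled linearisation error vanishes; the
    bound [Cd] then carries convergence back through ['d F a]. *)
Lemma inverse_quotient_cvg (R : realType) (V : normedModType R) (F M : V -> V)
  (a z : V) (C : R) (T : Type) (G : set_system T) (s : T -> R) (k : T -> V) :
  Filter G -> differentiable F a -> is_inverse ('d F a) M ->
  0 <= C -> (forall x, `|x| <= C * `|'d F a x|) ->
  k @ G --> a ->
  (\forall h \near G, `|k h - a| <= C * `|F (k h) - F a|) ->
  (s h *: (F (k h) - F a)) @[h --> G] --> z ->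
  (s h *: (k h - a)) @[h --> G] --> M z.
Proof.
move=> FG dF inv C0 Cd ka kC Fz.
have Lz : (s h *: 'd F a (k h - a)) @[h --> G] --> z.
  rewrite -[z]addr0.
  suff o0 : (s h *: ('d F a (k h - a) - (F (k h) - F a))) @[h --> G] --> (0 : V).
    apply: cvg_trans (cvgD Fz o0); apply: near_eq_cvg; near=> h.
    by rewrite !fctE /= -scalerDr addrC subrK.
  apply/cvgr0Pnorm_le => e e0.
  (* [C * (|z| + 1)] eventually bounds the scaled increments of [k]; the extra 1 keeps [c] positive
     when [C = 0]. *)
  pose c := C * (`|z| + 1) + 1.
  have c0 : 0 < c by rewrite ltr_wpDl// mulr_ge0// addr_ge0.
  have dec := differentiable_le dF (divr_gt0 e0 c0).
  have dec' := ka _ dec.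
  have Fb : \forall h \near G, `|s h *: (F (k h) - F a)| <= `|z| + 1.
    by apply: cvgr_norm_le Fz _ _; rewrite ltrDl.
  near=> h.
  have H1 : `|F (k h) - F a - 'd F a (k h - a)| <= e / c * `|k h - a|.
    by near: h.
  have H2 : `|k h - a| <= C * `|F (k h) - F a| by near: h.
  have H3 : `|s h *: (F (k h) - F a)| <= `|z| + 1 by near: h.
  rewrite normrZ distrC (le_trans (ler_wpM2l _ H1))//.
  rewrite mulrCA mulrAC ler_pdivrMr// ler_wpM2l ?(ltW e0)//.
  rewrite (le_trans (ler_wpM2l _ H2))// mulrCA -normrZ.
  by rewrite /c ler_wpDr// ler_wpM2l.
apply/cvgrPdist_le => e e0.
have C1 : 0 < C + 1 by rewrite ltr_wpDl.
have /cvgrPdist_le/(_ _ (divr_gt0 e0 C1)) := Lz.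
apply: filterS => h Hh; rewrite (le_trans (Cd _))//.
rewrite linearB linearZ (inv z).1 (le_trans (ler_wpM2l C0 Hh))//.
by rewrite mulrCA ler_piMr ?ltW// ltr_pdivrMr// mul1r ltrDl.
Unshelve. all: by end_near. Qed.

Lemma is_derive_scale (R : realType) (V : normedModType R) (c : R -> R)
  (p : R -> V) (t c' : R) (p' : V) :
  is_derive t 1 c c' -> is_derive t 1 p p' ->
  is_derive t 1 (fun s => c s *: p s) (c' *: p t + c t *: p').
Proof.
move=> dc dp.
have pt : p (h + t) @[h --> 0^'] --> p t.
  have /derivable1_diffP/differentiable_continuous pc := @ex_derive _ _ _ _ _ _ _ dp.
  suff ht : (h + t) @[h --> (0 : R)^'] --> t by exact: (cvg_comp _ _ ht pc).
  rewrite -[X in _ --> X]add0r; apply: cvgD; last exact: cvg_cst.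
  exact: cvg_within.
move/is_derive1P in dc; move/is_derive1P in dp; apply/is_derive1P.
(* Leibniz splitting with [p] taken at the moved point, whence the need for continuity of [p] at
   [t]. *)
have -> : (fun h => h^-1 *: (c (h + t) *: p (h + t) - c t *: p t)) =
    (fun h => (h^-1 *: (c (h + t) - c t)) *: p (h + t) +
              c t *: (h^-1 *: (p (h + t) - p t))).
  apply/funext => h.
  rewrite -[h^-1 *: (c (h + t) - c t)]/(h^-1 * (c (h + t) - c t)).
  rewrite [c t *: (_ *: _)]scalerA [c t * _]mulrC -!scalerA -scalerDr.
  by rewrite scalerBl [c t *: (_ - _)]scalerBr addrA subrK.
apply: cvgD; first exact: cvgZ.
by apply: cvgZ => //; exact: cvg_cst.
Qed.

(** * Inverting [F] on a closed ball *)

Lemma closed_cball (R : realType) (V : normedModType R) (y : V) (r : R) :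
  closed (cball y r).
Proof.
have -> : cball y r = closed_ball_ Num.norm y r.
  by apply/seteqP; split => x; rewrite /cball /closed_ball_ /= distrC.
exact: closed_closed_ball_.
Qed.

Lemma cball_segment (R : realType) (V : normedModType R) (y u v : V) (r s : R) :
  0 <= s <= 1 -> cball y r u -> cball y r v -> cball y r (v + s *: (u - v)).
Proof.
move=> /andP[s0 s1]; rewrite /cball /= => ur vr.
have -> : v + s *: (u - v) - y = (1 - s) *: (v - y) + s *: (u - y).
  rewrite scalerBl scale1r -[RHS]addrA [- _ + _]addrC -scalerBr.
  by rewrite opprB [u - y + _]addrA subrK addrAC.
rewrite (le_trans (ler_normD _ _))// !normrZ !ger0_norm ?subr_ge0//.
have -> : r = (1 - s) * r + s * r by ring.
by rewrite lerD// ler_wpM2l ?subr_ge0.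
Qed.

Section Chord.
Context (R : realType) (V : completeNormedModType R) (ip : V -> V -> R).
Context (Hip : is_inner_product ip).
Context (F M0 : V -> V) (y : V) (r m k : R).
Context (dF : forall u, cball y r u -> differentiable F u).
Context (M0inv : is_inverse ('d F y) M0) (m0 : 0 <= m).
Context (M0m : forall x, `|M0 x| <= m * `|x|).
Context (dFk : forall u, cball y r u ->
  forall x, `|'d F u x - 'd F y x| <= k * `|x|).

(** The mean value inequality for [x - M0 (F x)] along the segment from [v] to [u], which stays in
    the ball by convexity. *)
Lemma chord_estimate u v : cball y r u -> cball y r v ->
  `|u - v - M0 (F u - F v)| <= m * k * `|u - v|.
Proof.
move=> ur vr.
have Mlin := inverse_linear (@linearP _ _ _ _ ('d F y)) M0inv.
have Mcont := linear_bound_continuous Mlin M0m.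
pose M := pack_linear Mlin.
pose x (s : R) := v + s *: (u - v).
have xr s : 0 <= s <= 1 -> cball y r (x s) by move=> s01; exact: cball_segment.
have dx (s : R) : is_derive s 1 x (u - v).
  apply/is_derive1P; apply: cvg_near_cst; near=> h.
  have h0 : h != 0 by near: h; exact: nbhs_dnbhs_neq.
  by rewrite /x opprD addrACA subrr add0r -scalerBl addrK scalerA mulVf// scale1r.
pose p := x - (M0 \o (F \o x)).
(* Two-sided even at the end points: [x] is defined on the whole line and [F] is differentiable at
   every point of the closed ball. *)
have dp (s : R) : 0 <= s <= 1 -> is_derive s 1 p (u - v - M0 ('d F (x s) (u - v))).
  move=> s01; apply: is_deriveB.
  apply: is_derive_linear => //.
  by apply: is_derive_chain => //; exact/dF/xr.
have := @mean_value_le R V ip Hip p (fun s => u - v - M0 ('d F (x s) (u - v)))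
  0 1 (m * k * `|u - v|) ler01 _ _ _.
have -> : p 1 - p 0 = u - v - M0 (F u - F v).
  have -> : p 1 = u - M0 (F u) by rewrite /p !fctE /= /x scale1r [v + _]addrC subrK.
  have -> : p 0 = v - M0 (F v) by rewrite /p !fctE /= /x scale0r addr0.
  by rewrite -[M0]/(M : V -> V) (linearB M) !opprB addrACA [RHS]addrACA [- v + _]addrC.
rewrite subr0 mulr1; apply.
- apply: derivable_within_continuous => s; rewrite in_itv /= => /dp dps.
  exact: ex_derive.
- by move=> s; rewrite in_itv /= => /andP[s0 s1]; apply: dp; rewrite !ltW.
- move=> s; rewrite in_itv /= => /andP[s0 s1].
  (* Writing [u - v] as [M0 ('d F y (u - v))] turns the derivative into [M0] of a difference of two
     differentials. *)
  rewrite -{1}[u - v](M0inv _).2 -[M0]/(M : V -> V) -linearB.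
  rewrite (le_trans (M0m _))// -mulrA ler_wpM2l// distrC.
  by apply: dFk; apply: xr; rewrite !ltW.
Unshelve. all: by end_near. Qed.

Lemma inverse_lipschitz u v : cball y r u -> cball y r v ->
  (1 - m * k) * `|u - v| <= m * `|F u - F v|.
Proof.
move=> ur vr; rewrite mulrBl mul1r lerBlDr.
rewrite -{1}(subrK (M0 (F u - F v)) (u - v)) (le_trans (ler_normD _ _))//.
by rewrite addrC lerD// chord_estimate.
Qed.

(** The solution is a fixed point of the simplified Newton map [phi], whose linear part is frozen at
    [y]. *)
Lemma cball_preimage g : 0 <= m * k < 1 -> 0 <= r ->
  m * `|g - F y| <= (1 - m * k) * r ->
  exists2 u, cball y r u & F u = g.
Proof.
move=> mk r0 gr.
have Mlin := inverse_linear (@linearP _ _ _ _ ('d F y)) M0inv.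
pose M := pack_linear Mlin.
have yr : cball y r y by rewrite /cball /= subrr normr0.
pose phi x := x - M0 (F x - g).
have phiB x z : phi x - phi z = x - z - M0 (F x - F z).
  have -> : F x - F z = F x - g - (F z - g) by rewrite opprB addrA subrK.
  by rewrite -[M0]/(M : V -> V) (linearB M) !opprB addrACA [RHS]addrACA [- z + _]addrC.
have phi_y : `|phi y - y| <= (1 - m * k) * r.
  by rewrite /phi addrAC subrr add0r normrN (le_trans (M0m _))// distrC.
have [|||x xr xE] := closed_contraction_fixpoint (phi := phi) mk
    (closed_cball (y := y) (r := r)) _ _ _.
- by exists y.
(* [phi x] is within [m * k * r] of [phi y], and [phi y] within [(1 - m * k) * r] of [y]; the two
   radii add up to [r]. *)
- move=> x xr; rewrite /cball /= -(subrK (phi y) (phi x)) -addrA.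
  rewrite (le_trans (ler_normD _ _))// [leRHS](_ : r = m * k * r + (1 - m * k) * r).
    rewrite lerD// phiB (le_trans (chord_estimate xr yr))// ler_wpM2l//.
    by case/andP: mk.
  by ring.
- by move=> x z xr zr; rewrite phiB chord_estimate.
exists x => //; apply/eqP; rewrite -subr_eq0; apply/eqP.
rewrite -[LHS](M0inv _).1.
have : M0 (F x - g) = 0.
  by apply: oppr_inj; rewrite oppr0; apply: (addrI x); rewrite addr0 [RHS]xE.
by move=> ->; rewrite linear0.
Qed.

End Chord.

(** * Solutions of the Cauchy problem *)

Lemma residual_decay (R : realType) (V : completeNormedModType R)
  (ip : V -> V -> R) (F : V -> V) (y h u0 : V) (r : R) (w : R -> V) :
  is_inner_product ip -> dsm_solution F y r h u0 w ->
  forall t, 0 <= t -> F (w t) = h + expR (- t) *: (F u0 - h).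
Proof.
move=> Hip [w0 wsol] t; rewrite le_eqVlt => /predU1P[<-|t0].
  by rewrite oppr0 expR0 scale1r addrC subrK w0.
(* Integrating factor: [p] has zero derivative at positive times, so the mean value inequality with
   constant 0 makes it constant on [[0, t]]. *)
pose p s := expR s *: (F (w s) - h).
have dp (s : R) : 0 < s -> is_derive s 1 p 0.
  move=> s0; have [_ [dF [M [Minv [dw _]]]]] := wsol s (ltW s0).
  have dFw := is_derive_chain (dw s0) dF.
  have dFwh : is_derive s 1 ((F \o w) - cst h) (h - F (w s)).
    apply: (is_derive_eq (is_deriveB _ _)).
    by rewrite subr0 linearN (Minv _).1 opprB.
  apply: (is_derive_eq (is_derive_scale (is_derive_expR s) dFwh)).
  by rewrite -scalerDr !fctE /= addrA subrK subrr scaler0.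
(* At time 0 only a right difference quotient is given; multiplied by [s], it yields right
   continuity. *)
have w_cont0 : w s @[s --> 0^'+] --> w 0.
  have [_ [_ [M [_ [_ /(_ erefl) dw]]]]] := wsol 0 (lexx 0).
  have sdw : s *: (s^-1 *: (w s - w 0)) @[s --> 0^'+] --> (0 : V).
    rewrite -(scale0r (- M (F (w 0) - h))); apply: (cvgZ _ dw).
    exact: (cvg_at_right_filter cvg_id).
  rewrite -[X in _ --> X]add0r.
  apply: cvg_trans (cvgD sdw (cvg_cst (w 0))); apply: near_eq_cvg.
  near=> s; have s0 : 0 < s by near: s; exact: nbhs_right_gt.
  by rewrite !fctE scalerA divff ?gt_eqF// scale1r subrK.
have pcont : {within `[0, t], continuous p}.
  apply/continuous_within_itvP => //; split.
  - move=> s; rewrite in_itv /= => /andP[s0 _].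
    by apply/differentiable_continuous/derivable1_diffP; have [] := dp _ s0.
  - apply: cvgZ; first exact/cvg_at_right_filter/continuous_expR.
    apply: cvgB; last exact: cvg_cst.
    have [_ [dF _]] := wsol 0 (lexx 0).
    exact: (cvg_comp _ _ w_cont0 (differentiable_continuous dF)).
  - apply: cvg_at_left_filter.
    by apply/differentiable_continuous/derivable1_diffP; have [] := dp _ t0.
have pE : p t = p 0.
  apply/eqP; rewrite -subr_eq0 -normr_le0 -[leRHS](mul0r (t - 0)).
  apply: (mean_value_le Hip (ltW t0) pcont (dp := fun=> 0)) => s.
    by rewrite in_itv /= => /andP[s0 _]; exact: dp.
  by rewrite normr0.
have : expR (- t) *: p t = expR (- t) *: p 0 by rewrite pE.
rewrite /p scalerA -expRD addNr expR0 !scale1r w0 => <-.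
by rewrite addrC subrK.
Unshelve. all: by end_near. Qed.

Lemma opnorm_le_omega (R : realType) (V : normedModType R) (F : V -> V)
  (y u v : V) (r s : R) :
  omega F y r s \is a fin_num -> cball y r u -> cball y r v -> `|u - v| <= s ->
  forall x, `|'d F u x - 'd F v x| <= fine (omega F y r s) * `|x|.
Proof.
move=> fin ur vr uvs; apply: (@opnorm_le _ _ (fun x => 'd F u x - 'd F v x)).
  by move=> a x; rewrite (linearZ_LR ('d F u)) (linearZ_LR ('d F v)) -scalerBr.
by rewrite fineK//; apply: ereal_sup_ubound; exists (u, v).
Qed.

Theorem theorem2 (R : realType) (V : completeNormedModType R)
  (ip : V -> V -> R) (Hip : is_inner_product ip)
  (F : V -> V) (y f : V) (Hf : F y = f)
  (Rad : R) (HRad : 0 < Rad)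
  (Hdiff : forall u, cball y Rad u -> differentiable F u)
  (Hcont : forall u, cball y Rad u -> forall e : R, 0 < e ->
     exists2 d : R, 0 < d & forall v, cball y Rad v -> `|u - v| < d ->
       (opnorm (fun x => ('d F u x - 'd F v x)%R) < e%:E)%E)
  (m : R) (Hm : 0 < m)
  (Hinv : exists Linv : V -> V,
     is_inverse ('d F y) Linv /\ (opnorm Linv <= m%:E)%E)
  (Homega_fin : forall r, r \in `[0, 2 * Rad] -> omega F y Rad r \is a fin_num)
  (Homega_cont : {within `[0, 2 * Rad], continuous (fun r => fine (omega F y Rad r))})
  (Homega_incr : {in `[0, 2 * Rad] &, forall r1 r2, r1 < r2 ->
      fine (omega F y Rad r1) < fine (omega F y Rad r2)})
  (Homega0 : omega F y Rad 0 = 0%E)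
  (q : R) (Hq : 0 < q < 1) (Hmq : m * fine (omega F y Rad Rad) = q)
  (h u0 : V) (Hu0 : cball y Rad u0)
  (delta : R) (Hdelta : 0 <= delta) (Hhf : `|h - f| <= delta)
  (Hdr : delta + `|F u0 - h| <= (1 - q) * Rad / m) :
  exists u : R -> V,
    [/\ dsm_solution F y Rad h u0 u,
        (forall w : R -> V, dsm_solution F y Rad h u0 w ->
           forall t, 0 <= t -> w t = u t)
      & exists2 uinf : V, u t @[t --> +oo] --> uinf & F uinf = h].
Proof.
have [M0 [M0inv M0m]] := Hinv.
have M0lin := inverse_linear (@linearP _ _ _ _ ('d F y)) M0inv.
have {}M0m : forall x, `|M0 x| <= m * `|x|.
  pose M := pack_linear M0lin.
  by apply: opnorm_le M0m => a x; exact: (linearZ_LR M).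
set k := fine (omega F y Rad Rad) in Hmq.
have [q0 q1] := andP Hq; have m0 := ltW Hm; have r0 := ltW HRad.
have yr : cball y Rad y by rewrite /cball /= subrr normr0.
(* Only comparisons with the centre [y] occur, so the modulus is needed at [Rad] and not at the
   diameter. *)
have dFk u : cball y Rad u -> forall x, `|'d F u x - 'd F y x| <= k * `|x|.
  move=> ur; apply: opnorm_le_omega => //; apply: Homega_fin.
  by rewrite in_itv /= r0 ler_peMl// ler1n.
have mk : 0 <= m * k < 1 by rewrite Hmq (ltW q0).
have q1' : 0 < 1 - q by rewrite subr_gt0.
(* A common bound for the Lipschitz constant of the inverse of [F] and for the inverses of its
   differentials on the ball. *)
pose C := m / (1 - q); have C0 : 0 <= C by rewrite divr_ge0// ltW.
have FC a b : cball y Rad a -> cball y Rad b -> `|a - b| <= C * `|F a - F b|.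
  move=> ar br; rewrite /C mulrAC ler_pdivlMr// mulrC -Hmq.
  exact: (inverse_lipschitz Hip Hdiff M0inv).
have Finj a b : cball y Rad a -> cball y Rad b -> F a = F b -> a = b.
  move=> ar br e; apply/subr0_eq/eqP; rewrite -normr_le0.
  by rewrite (le_trans (FC _ _ ar br))// e subrr normr0 mulr0.
have dC a : cball y Rad a -> forall x, `|x| <= C * `|'d F a x|.
  move=> ar x; rewrite /C mulrAC ler_pdivlMr// mulrC -Hmq.
  exact: (perturbed_inverse_bound M0inv m0 M0m (dFk _ ar)).
(* The whole segment from [h] to [F u0] is attained: its points lie within [delta + |F u0 - h|] of
   [f]. The end [c = 0] will supply the limit point. *)
have Fsurj c : 0 <= c <= 1 ->
    exists2 u, cball y Rad u & F u = h + c *: (F u0 - h).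
  move=> /andP[c0 c1]; apply: (cball_preimage Hip Hdiff M0inv m0 M0m dFk mk r0).
  rewrite Hmq Hf mulrC -ler_pdivlMr//; apply: le_trans Hdr.
  rewrite addrAC (le_trans (ler_normD _ _))// lerD// normrZ ger0_norm//.
  by rewrite ler_piMl.
have expNt (t : R) : 0 <= t -> 0 <= expR (- t) <= 1.
  by move=> t0; rewrite expR_ge0 /= -expR0 ler_expR oppr_le0.
pose g (t : R) := h + expR (- t) *: (F u0 - h).
have [u uP] : exists u : R -> V, forall t, 0 <= t ->
    cball y Rad (u t) /\ F (u t) = g t.
  have ex t : exists x, 0 <= t -> cball y Rad x /\ F x = g t.
    (* At negative times nothing is required of [u], so an arbitrary value will do. *)
    have [t0|t0] := leP 0 t; last by exists 0.
    by have [x xr xE] := Fsurj _ (expNt _ t0); exists x.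
  by have [u uP] := choice ex; exists u.
have ur t : 0 <= t -> cball y Rad (u t) by move=> /uP[].
have uE t : 0 <= t -> F (u t) = g t by move=> /uP[].
have dg (t : R) : is_derive t 1 g (- (g t - h)).
  have de : is_derive t 1 (fun s => expR (- s)) (- expR (- t)).
    apply: (is_derive_eq (is_derive1_comp (is_derive_expR _) (is_deriveNid _ _))).
    by rewrite mulrN1.
  apply: (is_derive_eq (is_deriveD (is_derive_cst h _ _)
           (is_derive_scale de (is_derive_cst (F u0 - h) _ _)))).
  by rewrite add0r scaler0 addr0 scaleNr /g addrAC subrr add0r.
have gcont : continuous g.
  by move=> t; apply/differentiable_continuous/derivable1_diffP; have [] := dg t.
have uC s t : 0 <= s -> 0 <= t -> `|u s - u t| <= C * `|g s - g t|.
  by move=> s0 t0; rewrite -!uE//; apply: FC; exact: ur.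
(* A general filter serves both the two-sided derivative and the one at 0. *)
have uquot (t : R) (G : set_system R) : Filter G -> 0 <= t ->
    (\forall s \near G, 0 <= s + t) -> (s + t) @[s --> G] --> t ->
    s^-1 *: (g (s + t) - g t) @[s --> G] --> - (g t - h) ->
    forall M, is_inverse ('d F (u t)) M ->
    s^-1 *: (u (s + t) - u t) @[s --> G] --> - M (F (u t) - h).
  move=> FG t0 st_ge0 st gq M Minv.
  have Mlin := inverse_linear (@linearP _ _ _ _ ('d F (u t))) Minv.
  pose M' := pack_linear Mlin.
  rewrite uE// -[- M _](linearN M').
  apply: (@inverse_quotient_cvg _ _ F M (u t) _ C _ G GRing.inv
    (fun s => u (s + t)) _ (Hdiff _ (ur _ t0)) Minv C0).
  - exact/dC/ur.
  - have gst : g (s + t) @[s --> G] --> g t by exact: (cvg_comp _ _ st (gcont t)).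
    apply/cvgrPdist_le => e e0.
    have C1 : 0 < C + 1 by rewrite ltr_wpDl.
    have /cvgrPdist_le/(_ _ (divr_gt0 e0 C1)) := gst.
    apply: filter_app; near=> s => gs.
    have s0 : 0 <= s + t by near: s.
    rewrite (le_trans (uC _ _ t0 s0))// (le_trans (ler_wpM2l C0 gs))//.
    by rewrite mulrCA ler_piMr ?(ltW e0)// ler_pdivrMr// mul1r lerDl.
  - by near=> s; apply: FC; apply: ur => //; near: s.
  - apply: cvg_trans gq; apply: near_eq_cvg; near=> s.
    by rewrite !uE//; near: s.
have usol : dsm_solution F y Rad h u0 u.
  split.
    (* [u 0] is merely some preimage of [F u0] in the ball; injectivity identifies it with [u0]. *)
    apply: Finj => //; first exact: ur.
    by rewrite uE// /g oppr0 expR0 scale1r addrC subrK.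
  move=> t t0; split; first exact: ur.
  split; first exact/Hdiff/ur.
  have [M Minv] := perturbed_inverse M0inv m0 M0m (dFk _ (ur _ t0)) mk.
  exists M; split => //; split => [t_gt0|t_eq0].
    apply/is_derive1P; apply: uquot => //.
    (* For [t > 0], small [s] keep [s + t] away from the negative times, where [u] is
       uncontrolled. *)
    + apply: nbhs_dnbhs; have : - t < 0 by rewrite oppr_lt0.
      move=> /lt_nbhsr; apply: filterS => s /ltW.
      by rewrite -subr_ge0 opprK.
    + rewrite -[X in _ --> X]add0r; apply: cvgD; last exact: cvg_cst.
      exact: cvg_within.
    + exact/is_derive1P.
  have : s^-1 *: (u (s + t) - u t) @[s --> 0^'+] --> - M (F (u t) - h).
    apply: uquot => //.
    + by near=> s; rewrite addr_ge0//; near: s; exact: nbhs_right_ge.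
    + rewrite -[X in _ --> X]add0r; apply: cvgD; last exact: cvg_cst.
      exact: cvg_within.
    + by apply: cvg_dnbhs_at_right; exact/is_derive1P.
  by rewrite t_eq0; under eq_fun do rewrite addr0.
exists u; split => //.
  (* Uniqueness: any solution stays in the ball and has the same image [g t] under [F]. *)
  move=> w wsol t t0; apply: Finj; [|exact: ur|].
  - by have [_ /(_ t t0)[]] := wsol.
  - by rewrite uE// (residual_decay Hip wsol).
have [uinf uinfr uinfE] : exists2 x, cball y Rad x & F x = h.
  by have := Fsurj 0; rewrite scale0r addr0 lexx ler01; exact.
exists uinf => //; apply/cvgrPdist_le => e e0.
have gh : g t @[t --> +oo] --> h.
  rewrite -[X in _ --> X]addr0 -(scale0r (F u0 - h)); apply: cvgD.
    exact: cvg_cst.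
  by apply: cvgZ; [exact: cvgr_expR|exact: cvg_cst].
have C1 : 0 < C + 1 by rewrite ltr_wpDl.
(* The Lipschitz inverse transfers [g t --> h] to [u]; [C + 1] replaces [C] as a positive
   divisor. *)
have /cvgrPdist_le/(_ _ (divr_gt0 e0 C1)) := gh.
apply: filter_app; near=> t => gt.
have t0 : 0 <= t by near: t; exact: nbhs_pinfty_ge.
rewrite (le_trans (FC _ _ uinfr (ur _ t0)))// uE// uinfE.
rewrite (le_trans (ler_wpM2l C0 gt))//.
by rewrite mulrCA ler_piMr ?(ltW e0)// ler_pdivrMr// mul1r lerDl.
Unshelve. all: by end_near. Qed.
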